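(* Let $N,m$ be positive integers, let $0<\beta<1/(2N+1)$, and let $\mathbf{t}=(t_0,t_1,\ldots,t_m)\in\mathbb{R}^{m+1}$ with $0=t_0<t_1<\cdots<t_m$. Let $\Gamma\subset\mathbb{R}$ be the unique non-empty compact set with $\Gamma=\bigcup_{i=0}^N\phi_i(\Gamma)$, where $\phi_i(x)=\beta x+i\frac{1-\beta}{N}$. Then $\Gamma_{\mathbf{t}}=\bigcup_{j=0}^m(\Gamma+t_j)$ is a self-similar set if and only if either $\mathbf{t}$ or its conjugate $\hat{\mathbf{t}}$ is an admissible translation vector.
   Context: A non-empty compact set $E\subset\mathbb{R}$ is called a self-similar set if there is a finite set of contractive similitudes $f_i(x)=r_ix+b_i$ ($0<|r_i|<1$, $b_i\in\mathbb{R}$, $1\le i\le n$) such that $E=\bigcup_{i=1}^n f_i(E)$. For $X\subset\mathbb{R}$, $b\in\mathbb{R}$, $X+b=\{x+b:x\in X\}$. The conjugate of $\mathbf{t}$ is $\hat{\mathbf{t}}=(\hat t_0,\ldots,\hat t_m)$ with $\hat t_j=t_m-t_{m-j}$ for $0\le j\le m$; again $0=\hat t_0<\cdots<\hat t_m$. Let $T=\bigcup_{n=1}^\infty\big\{\frac{1-\beta}{N}\sum_{k=1}^n j_k\beta^{-k}: j_k\in\{0,1,\ldots,N\}\ \forall\,1\le k\le n\big\}$. For $\mathbf{t}=(t_0,\ldots,t_m)\in T^{m+1}$ with $0=t_0<t_1<\cdots<t_m$, let $\tau=\tau_{\mathbf{t}}$ be the smallest positive integer such that every $t_j$ ($0\le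 j\le m$) can be written as $t_j=\frac{1-\beta}{N}\sum_{k=1}^{\tau}t_{j,k}\beta^{-k}$ with $t_{j,k}\in\{0,1,\ldots,N\}$ (the digits $t_{j,k}$ are unique since $\beta<1/(N+1)$). Put $s_k=\max_{0\le j\le m}t_{j,k}$ for $1\le k\le\tau$. Define $\Omega_{\mathbf{t}}^{\tau}=\{i_1\cdots i_\tau\in\{0,\ldots,N\}^\tau: i_{\tau+1-k}\le N-s_k \text{ for }1\le k\le\tau\}$ and $\hat\Omega_{\mathbf{t}}^{\tau}=\{i_1\cdots i_\tau\in\{0,\ldots,N\}^\tau: i_{\tau+1-k}\ge s_k\text{ for }1\le k\le\tau\}$. Define the sets of words $\mathcal{A}_{\mathbf{t}}^{\tau}=\{(i_1+t_{j,\tau})(i_2+t_{j,\tau-1})\cdots(i_\tau+t_{j,1}): i_1\cdots i_\tau\in\Omega_{\mathbf{t}}^\tau,\ 0\le j\le m\}$, $\hat{\mathcal{A}}_{\mathbf{t}}^{\tau}=\{(i_1-t_{j,\tau})(i_2-t_{j,\tau-1})\cdots(i_\tau-t_{j,1}): i_1\cdots i_\tau\in\hat\Omega_{\mathbf{t}}^\tau,\ 0\le j\le m\}$, and $\mathcal{W}_{\mathbf{t}}^{\tau}=\mathcal{A}_{\mathbf{t}}^\tau\cup\hat{\mathcal{A}}_{\mathbf{t}}^\tau\subset\{0,\ldots,N\}^\tau$. A vector $\mathbf{t}\in\mathbb{R}^{m+1}$ with $0=t_0<t_1<\cdots<t_m$ is an admissible translation vector if $\mathbf{t}\in T^{m+1}$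 and there exists $\ell\ge\tau_{\mathbf{t}}$ such that $\bigcup_{n=\tau_{\mathbf{t}}}^{\ell}\{0,\ldots,N\}^{n-\tau_{\mathbf{t}}}\times\mathcal{W}_{\mathbf{t}}^{\tau_{\mathbf{t}}}\times\{0,\ldots,N\}^{\ell-n}=\{0,\ldots,N\}^\ell$ (products meaning concatenation of words). *)

(* Defs.v *)
From HB Require Import structures.
From mathcomp Require Import all_boot all_order all_algebra.
From mathcomp Require Import all_classical all_reals all_analysis.
Import Order.TTheory GRing.Theory Num.Theory.
Import numFieldNormedType.Exports.

Set Implicit Arguments.
Unset Strict Implicit.
Unset Printing Implicit Defensive.

Local Open Scope classical_set_scope.
Local Open Scope ring_scope.

Definition self_similar (R : realType) (E : set R) : Prop :=
  [/\ E !=set0, compact E &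
      exists n (r b : 'I_n -> R),
        (forall i, 0 < `|r i| < 1) /\
        E = \bigcup_(i in [set: 'I_n]) ((fun x => r i * x + b i) @` E)].

Definition phi (R : realType) (beta : R) (N i : nat) (x : R) : R :=
  beta * x + i%:R * ((1 - beta) / N%:R).

(* By Hutchinson's theorem exactly one set satisfies this when 0 < beta < 1. *)
Definition is_attractor (R : realType) (beta : R) (N : nat) (G : set R) : Prop :=
  [/\ G !=set0, compact G &
      G = \bigcup_(i in [set: 'I_N.+1]) (phi beta N i @` G)].

Definition translate (R : realType) (X : set R) (b : R) : set R :=
  [set x + b | x in X].

Definition Gamma_union (R : realType) (m : nat) (G : set R)
    (t : 'I_m.+1 -> R) : set R :=
  \bigcup_(j in [set: 'I_m.+1]) translate G (t j).

Definition increasing_from0 (R : realType) (m : nat) (t : 'I_m.+1 -> R) : Prop :=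
  t ord0 = 0 /\ (forall i j : 'I_m.+1, (i < j)%N -> t i < t j).

(* [rev_ord j] has value [m - j]. *)
Definition conjugate (R : realType) (m : nat) (t : 'I_m.+1 -> R) :
    'I_m.+1 -> R :=
  fun j => t ord_max - t (rev_ord j).

(* Digit sequences are functions on nat of which only the values at
   1 <= k <= n are relevant. *)
Definition is_expansion (R : realType) (beta : R) (N n : nat) (x : R)
    (d : nat -> nat) : Prop :=
  (forall k, (1 <= k <= n)%N -> (d k <= N)%N) /\
  x = (1 - beta) / N%:R * \sum_(1 <= k < n.+1) (d k)%:R * beta ^- k.

Definition expandable (R : realType) (beta : R) (N n : nat) : set R :=
  [set x | exists d, is_expansion beta N n x d].

Definition T (R : realType) (beta : R) (N : nat) : set R :=
  \bigcup_(n in [set n | (0 < n)%N]) expandable beta N n.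

Definition is_tau (R : realType) (beta : R) (N m : nat) (t : 'I_m.+1 -> R)
    (tau : nat) : Prop :=
  [/\ (0 < tau)%N,
      forall j, expandable beta N tau (t j) &
      forall n, (0 < n)%N -> (forall j, expandable beta N n (t j)) ->
        (tau <= n)%N].

Definition words (N n : nat) : set (seq nat) :=
  [set w | size w = n /\ all (fun a => a <= N)%N w].

Definition catset (A B : set (seq nat)) : set (seq nat) :=
  [set u ++ v | u in A & v in B].

(* In the sets below [d j k] is the digit t_{j,k}. Words are sequences indexed
   from 0, so the letter i_{tau+1-k} is [nth 0 i (tau - k)], and the letter at
   position [p] is paired with the digit of index [tau - p]. *)
Definition smax (m : nat) (d : 'I_m.+1 -> nat -> nat) (k : nat) : nat :=
  (\max_(j < m.+1) d j k)%N.

Definition Omega (N m tau : nat) (d : 'I_m.+1 -> nat -> nat) : set (seq nat) :=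
  [set i | words N tau i /\
    forall k, (1 <= k <= tau)%N -> (nth 0 i (tau - k) <= N - smax d k)%N].

Definition Omega_hat (N m tau : nat) (d : 'I_m.+1 -> nat -> nat) :
    set (seq nat) :=
  [set i | words N tau i /\
    forall k, (1 <= k <= tau)%N -> (smax d k <= nth 0 i (tau - k))%N].

Definition calA (N m tau : nat) (d : 'I_m.+1 -> nat -> nat) : set (seq nat) :=
  [set mkseq (fun p => nth 0 i p + d j (tau - p))%N tau
    | i in Omega N tau d & j in [set: 'I_m.+1]].

(* The subtraction never truncates, since [d j k <= smax d k]. *)
Definition calA_hat (N m tau : nat) (d : 'I_m.+1 -> nat -> nat) :
    set (seq nat) :=
  [set mkseq (fun p => nth 0 i p - d j (tau - p))%N tau
    | i in Omega_hat N tau d & j in [set: 'I_m.+1]].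

Definition calW (N m tau : nat) (d : 'I_m.+1 -> nat -> nat) : set (seq nat) :=
  calA N tau d `|` calA_hat N tau d.

(* [tau] is determined by [t], and for beta < 1 / (N + 1) so are the relevant
   values of [d]; hence quantifying existentially over them names the tau and
   the digits of [t]. *)
Definition admissible (R : realType) (beta : R) (N m : nat)
    (t : 'I_m.+1 -> R) : Prop :=
  [/\ increasing_from0 t,
      forall j, T beta N (t j) &
      exists tau (d : 'I_m.+1 -> nat -> nat),
        [/\ is_tau beta N t tau,
            forall j, is_expansion beta N tau (t j) (d j) &
            exists2 l, (tau <= l)%N &
              \bigcup_(n in [set n | (tau <= n <= l)%N])
                catset (words N (n - tau))
                  (catset (calW N tau d) (words N (l - n)))
              = words N l]].

(* Main.v *)
Require Import Defs.
From mathcomp Require Import all_boot all_order all_algebra.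
From mathcomp Require Import all_classical all_reals all_analysis.
From mathcomp Require Import lra ring zify.
Import Order.TTheory GRing.Theory Num.Theory.
Import numFieldNormedType.Exports.
Local Open Scope classical_set_scope.
Local Open Scope ring_scope.

Set Implicit Arguments.
Unset Strict Implicit.
Unset Printing Implicit Defensive.

(** Write [phi_w] for the composite of the maps [phi_i] along a word [w], and
[E] for the union of the translates of [Gamma]. Since [beta < 1 / (2 N + 1)],
the gaps between the first level cylinders of [Gamma] are wider than the
cylinders themselves, and digits are determined not only for points of [Gamma]
but also for sums and differences of two such points ([phi_inj]). Multiplying
[t_j] by [beta ^ tau] turns its expansion into a word of length [tau], so that
translating by [t_j] inside a cylinder of length [tau] adds the digits of [t_j]
to the word, as long as no carry occurs.

Sufficiency. By the last remark, a word [i] of [Omega] gives a contraction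
[phi_i] mapping all of [E] into [Gamma], and a word of [Omega_hat] gives the
contraction [x |-> phi_i (1 - x)], because [Gamma = 1 - Gamma]. The images of
[Gamma + t_j] are exactly the cylinders of the words in [calW]. Admissibility
says that every long word has such a word as a factor, so [Gamma] is covered by
finitely many contracted copies of [E] inside [Gamma]; translating by the [t_j]
covers [E].

Necessity. The key is rigidity ([affine_rigidity]): an affine map sending
[Gamma] into itself is [phi_u] or [x |-> phi_u (1 - x)] for some word [u]. If
its ratio is less than 1, the images of consecutive first level pieces are too
close to each other to jump across a gap, so the whole image lies in one
cylinder; rescaling that cylinder divides the ratio by [beta], and one repeats.
Now suppose that [E] is self-similar. Iterating its similitudes covers every
point of [E] by an arbitrarily small copy of [E] ([self_similar_small_pieces]),
and near 0 the set [E] coincides with [Gamma]. A small copy of [E] around 0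
therefore has ratio [beta ^ q] or [- beta ^ q]; it has its minimum at 0, which
puts [beta ^ q (Gamma + t_j)] inside [Gamma] in the first case, and the same
for the conjugate vector in the second ([small_piece_ratio]). So [t] or its
conjugate has all its entries in [T] ([T_of_scaled_translate]), and after a
reflection one may assume that it is [t]. Finally cover the point
[beta ^ p * phi_w(0)] by a small copy of [E] inside [Gamma], with [w] any
sufficiently long word. By rigidity and uniqueness of digits the copy is a union
of cylinders whose words end in [calW] ([calW_of_piece]); one of these words is
a prefix of [0^p w], which exhibits an element of [calW] as a factor of [w]. *)

(** * Preliminaries on self-similar sets and translation vectors *)

Lemma mkseq_cons (X : Type) (f : nat -> X) n :
  mkseq f n.+1 = f 0%N :: mkseq (fun p => f p.+1) n.
Proof. by rewrite /mkseq /= (iotaDl 1 0) -map_comp. Qed.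

Lemma expr_lt_ex (R : realType) (b e : R) : 0 < b < 1 -> 0 < e -> exists n, b ^+ n < e.
Proof.
move=> /andP[b0 b1] e0.
have b1' : `|b| < 1 by rewrite gtr0_norm.
have /cvgr0Pnorm_lt/(_ e e0)[n _ /(_ n (leqnn n))/= H] := cvg_expr b1'.
by exists n; move: H; rewrite ger0_norm// exprn_ge0// ltW.
Qed.

(** Iterating the similitudes of [E] makes the pieces small. The lower bound
[del] on the ratios, uniform in [x], stands in for the finiteness of the family
of iterated maps: it will bound the lengths of the words that code the pieces. *)
Lemma self_similar_small_pieces (R : realType) (E : set R) : self_similar E ->
  forall e, 0 < e -> exists2 del, 0 < del & forall x, E x ->
    exists r b, [/\ del <= `|r| < e, forall y, E y -> E (r * y + b) &
      exists2 y, E y & x = r * y + b].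
Proof.
case=> _ _ [n [r [b [rb EE]]]] e e0.
pose lo := \big[Num.min/1]_i `|r i|; pose hi := \big[Num.max/(2^-1)]_i `|r i|.
have lo0 : 0 < lo by apply: lt_bigmin => // i _; case/andP: (rb i).
have hi1 : hi < 1 by apply: bigmax_lt => [|i _]; [lra | case/andP: (rb i)].
have hi0 : 0 < hi by apply: (@lt_le_trans _ _ (2^-1)); [lra | exact: bigmax_ge_id].
have [k ke] := expr_lt_ex (introT andP (conj hi0 hi1)) e0.
exists (lo ^+ k); first exact: exprn_gt0.
suff H x : E x -> exists r b, [/\ lo ^+ k <= `|r| <= hi ^+ k,
    forall y, E y -> E (r * y + b) & exists2 y, E y & x = r * y + b].
  move=> x /H[r' [b' [/andP[? ?] ? ?]]]; exists r', b'; split => //.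
  by apply/andP; split => //; apply: le_lt_trans ke.
elim: k {ke} x => [|k IH] x Ex.
  exists 1, 0; split; first by rewrite normr1 !expr0 lexx.
    by move=> y; rewrite mul1r addr0.
  by exists x => //; rewrite mul1r addr0.
have [r' [b' [/andP[r1 r2] fE [y Ey ->]]]] := IH _ Ex.
move: (Ey); rewrite {1}EE => -[i _ [z Ez <-]].
have fi u : E u -> E (r i * u + b i) by move=> Eu; rewrite EE; exists i => //; exists u.
exists (r' * r i), (r' * b i + b'); split.
- rewrite normrM !exprSr; apply/andP; split; apply: ler_pM => //.
  + exact/exprn_ge0/ltW.
  + exact: ltW.
  + exact: bigmin_le.
  + exact: le_bigmax.
- by move=> u Eu; rewrite (_ : _ + _ = r' * (r i * u + b i) + b');
    [by apply: fE; apply: fi | ring].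
- by exists z => //; ring.
Qed.

(** To exhibit self-similarity it is convenient to index the maps by any finite
type and to discard, through a predicate [P], those not mapping [E] into [E]. *)
Lemma self_similar_finType (R : realType) (E : set R) (I : finType) (P : I -> Prop)
    (r b : I -> R) :
  E !=set0 -> compact E ->
  (forall i, P i -> 0 < `|r i| < 1) ->
  (forall i x, P i -> E x -> E (r i * x + b i)) ->
  (forall x, E x -> exists i y, [/\ P i, E y & x = r i * y + b i]) ->
  self_similar E.
Proof.
move=> E0 Ec rP fE Ef; split => //.
pose A := [pred i | `[< P i >]].
have AP (k : 'I_#|A|) : P (enum_val k).
  by apply/asboolP; exact: (enum_valP k).
exists #|A|, (fun k => r (enum_val k)), (fun k => b (enum_val k)); split.
  by move=> k; exact: rP.
apply/seteqP; split => x.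
  move=> /Ef[i [y [Pi Ey ->]]].
  have Ai : i \in A by apply/asboolP.
  by exists (enum_rank_in Ai i) => //; exists y => //; rewrite enum_rankK_in.
by move=> [k _ [y Ey <-]]; apply: fE.
Qed.

Lemma self_similar_flip (R : realType) (E : set R) c :
  self_similar E -> self_similar ((fun x => c - x) @` E).
Proof.
case=> -[x0 Ex0] Ec [n [r [b [rb EE]]]]; split.
- by exists (c - x0), x0.
- apply: continuous_compact Ec; apply: continuous_subspaceT => x.
  by apply: continuousB; [exact: cvg_cst | exact: cvg_id].
exists n, r, (fun i => c - b i - r i * c); split => //.
apply/seteqP; split => x.
  move=> [y]; rewrite {1}EE => -[i _ [z Ez <-] <-]; exists i => //.
  by exists (c - z); [exists z | ring].
move=> [i _ [_ [z Ez <-] <-]]; exists (r i * z + b i); last by ring.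
by rewrite EE; exists i => //; exists z.
Qed.

Lemma image_flipK (R : realType) (E : set R) c :
  (fun x => c - x) @` ((fun x => c - x) @` E) = E.
Proof.
apply/seteqP; split => x; first by move=> [_ [y Ey <-] <-]; rewrite subKr.
by move=> Ex; exists (c - x); [exists x | rewrite subKr].
Qed.

Lemma increasing_conjugate (R : realType) m (t : 'I_m.+1 -> R) :
  increasing_from0 t -> increasing_from0 (conjugate t).
Proof.
move=> [t0 tlt]; split; rewrite /conjugate.
  by rewrite (_ : rev_ord ord0 = ord_max) ?subrr//; apply/val_inj; rewrite /= subn1.
move=> i j ij; rewrite ltrD2l ltrN2 tlt//=.
have := ltn_ord i; have := ltn_ord j; lia.
Qed.

Lemma expandable_mono (R : realType) (beta : R) N n n' x : (n <= n')%N ->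
  expandable beta N n x -> expandable beta N n' x.
Proof.
move=> nn [d [dN ->]]; exists (fun k => if (k <= n)%N then d k else 0%N); split.
  by move=> k /andP[k1 _]; case: ifP => // kn; apply: dN; rewrite k1.
congr (_ * _); rewrite [RHS](big_cat_nat (n := n.+1))//=.
rewrite [X in _ = _ + X]big_nat_cond [X in _ = _ + X]big1 ?addr0.
  by rewrite !big_nat; apply: eq_bigr => k; rewrite ltnS => /andP[_ ->].
by move=> k; rewrite andbT => /andP[nk _]; rewrite leqNgt nk mul0r.
Qed.

(** The finitely many entries of [t] have expansions of a common length, by
padding with zeros; the least such length is tau. *)
Lemma is_tau_ex (R : realType) (beta : R) N m (t : 'I_m.+1 -> R) :
  (forall j, T beta N (t j)) -> exists tau, is_tau beta N t tau.
Proof.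
move=> tT.
have /choice[n nP] : forall j, exists n, (0 < n)%N /\ expandable beta N n (t j).
  by move=> j; have [n n0 ne] := tT j; exists n.
pose Q := [pred n | (0 < n)%N && `[< forall j, expandable beta N n (t j) >]].
have exQ : exists n, Q n.
  exists (\max_j n j)%N; apply/andP; split.
    by apply: leq_trans (leq_bigmax ord0); case: (nP ord0).
  by apply/asboolP => j; apply: expandable_mono (nP j).2; exact: leq_bigmax.
case: (ex_minnP exQ) => tau /andP[tau0 /asboolP te] tmin.
exists tau; split => // k k0 ke; apply: tmin.
by rewrite /= k0; apply/asboolP.
Qed.

(** * The Cantor set and its coding by words *)

Section Cantor.
Variables (R : realType) (N : nat) (beta : R) (G : set R).
Hypothesis (hN : (0 < N)%N).
Hypothesis (hbeta : 0 < beta < 1 / (2 * N + 1)%:R).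
Hypothesis (hG : is_attractor beta N G).

Local Notation h := ((1 - beta) / N%:R).
Local Notation phi := (phi beta N).

Let beta_gt0 : 0 < beta. Proof. by case/andP: hbeta. Qed.

Let N_gt0 : 0 < N%:R :> R. Proof. by rewrite ltr0n. Qed.

Let hNE : N%:R * h = 1 - beta.
Proof. by rewrite mulrC divfK// gt_eqF. Qed.

Let betaN : (2 * N%:R + 1) * beta < 1.
Proof.
case/andP: hbeta => _; rewrite ltr_pdivlMr; last by rewrite ltr0n addn1.
by rewrite natrD natrM mulrC.
Qed.

Let h_gt2beta : 2 * beta < h.
Proof.
rewrite ltr_pdivlMr//; have := betaN; nra.
Qed.

Let beta_lt1 : beta < 1.
Proof. by have := betaN; have := beta_gt0; have := N_gt0; nra. Qed.

Let h_gt0 : 0 < h.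
Proof. by have := h_gt2beta; have := beta_gt0; lra. Qed.

Lemma mem_phi i x : (i <= N)%N -> G x -> G (phi i x).
Proof.
case: hG => _ _ GE iN Gx; rewrite GE.
exists (Ordinal (iN : (i < N.+1)%N)) => //; by exists x.
Qed.

Lemma phi_decomp x : G x -> exists i y, [/\ (i <= N)%N, G y & x = phi i y].
Proof.
case: hG => _ _ GE; rewrite {1}GE => -[i _ [y Gy <-]].
by exists i, y; split => //; rewrite -ltnS.
Qed.

Lemma digit_bound i : (i <= N)%N -> i%:R * h <= 1 - beta.
Proof. by move=> iN; rewrite -[leRHS]hNE ler_wpM2r ?ler_nat// ltW. Qed.

(** The minimum [a] of [G] satisfies [a <= phi_0(a) = beta a] because [phi_0(a)]
lies in [G], and [a >= beta a] because [a] has a preimage in [G] above [a]; so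
it vanishes. The maximum is treated in the same way with [phi_N]. *)
Lemma attractor_extremes : [/\ G 0, G 1 & forall x, G x -> 0 <= x <= 1].
Proof.
case: (hG) => Gne Gc _.
have idc : {within G, continuous (fun x : R => x)}.
  by apply: continuous_subspaceT => x; exact: cvg_id.
have [a Ga amin] := compact_EVT_min Gne Gc idc.
have [b Gb bmax] := compact_EVT_max Gne Gc idc.
rewrite inE in Ga; rewrite inE in Gb.
have a0 : a = 0.
  have /= := amin (phi 0%N a); rewrite inE => /(_ (mem_phi (leq0n _) Ga)).
  have [i [y [iN Gy ay]]] := phi_decomp Ga.
  have /= := amin y; rewrite inE => /(_ Gy).
  move: ay; rewrite /Defs.phi; have : 0 <= i%:R * h by rewrite mulr_ge0// ltW.
  by move: beta_gt0 beta_lt1; nra.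
have b1 : b = 1.
  have /= := bmax (phi N b); rewrite inE => /(_ (mem_phi (leqnn _) Gb)).
  have [i [y [iN Gy ay]]] := phi_decomp Gb.
  have /= := bmax y; rewrite inE => /(_ Gy).
  move: ay; rewrite /Defs.phi hNE; have := digit_bound iN.
  by move: beta_gt0 beta_lt1; nra.
subst a b; split => // x Gx; apply/andP; split.
- by apply: amin; rewrite inE.
- by apply: bmax; rewrite inE.
Qed.

Lemma attractor0 : G 0. Proof. by case: attractor_extremes. Qed.

Lemma attractor1 : G 1. Proof. by case: attractor_extremes. Qed.

Lemma attractor_itv x : G x -> 0 <= x <= 1.
Proof. by case: attractor_extremes => _ _; exact. Qed.

(** The reflection [x |-> 1 - x] exchanges [phi_i] and [phi_(N - i)], so [1 - G]
is again invariant. Following the address of [x] for [n] steps gives a point of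
[G] at distance at most [beta ^ n] from [1 - x], and [G] is closed. *)
Lemma attractor_symmetric x : G x -> G (1 - x).
Proof.
have approx n : forall z, G z -> exists2 y, G y & `|1 - z - y| <= beta ^+ n.
  elim: n => [|n IH] z Gz.
    exists 0; first exact: attractor0.
    by have := attractor_itv Gz; rewrite expr0 ler_norml; lra.
  have [i [z' [iN Gz' ->]]] := phi_decomp Gz.
  have [y Gy yz] := IH _ Gz'.
  exists (phi (N - i) y); first by apply: mem_phi => //; rewrite leq_subr.
  have -> : phi (N - i) y = beta * y + (1 - beta - i%:R * h).
    by rewrite /Defs.phi natrB// [(_ - _) * _]mulrBl hNE.
  rewrite /Defs.phi; set k := _ * h.
  rewrite (_ : _ - _ = beta * (1 - z' - y)); last by ring.
  by rewrite normrM gtr0_norm// exprS ler_pM2l.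
move=> Gx.
have Gcl : closed G.
  by case: hG => _ Gc _; apply: compact_closed Gc; exact: Rhausdorff.
apply: Gcl => B /nbhs_ballP[e /= e0 eB].
have [n ne] := expr_lt_ex (introT andP (conj beta_gt0 beta_lt1)) e0.
have [y Gy yx] := approx n x Gx.
exists y; split => //; apply: eB => /=.
exact: le_lt_trans yx ne.
Qed.

(** Distinct first level cylinders are at distance at least
[(1 - beta) / N - beta]. *)
Lemma phi_separated i j (x y : R) : 0 <= x <= 1 -> 0 <= y <= 1 ->
  `|phi i x - phi j y| < h - beta -> i = j.
Proof.
have aux a b (u v : R) : (a < b)%N -> 0 <= u <= 1 -> 0 <= v <= 1 ->
    h - beta <= phi b v - phi a u.
  move=> ab hu hv.
  have : (a%:R + 1) * h <= b%:R * h.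
    by rewrite ler_wpM2r//; [exact: ltW | rewrite natr1 ler_nat].
  rewrite /Defs.phi.
  set k := h; move: (beta_gt0); nra.
move=> hx hy; rewrite ltr_norml => H.
case: (ltngtP i j) => // ij.
- by exfalso; have := aux _ _ _ _ ij hx hy; lra.
- by exfalso; have := aux _ _ _ _ ij hy hx; lra.
Qed.

(** This is where [beta < 1 / (2 N + 1)] is used in full: it says that
[2 beta < (1 - beta) / N], so that a first digit can be recovered even when the
remainders range over an interval of length 2, as they do for sums and
differences of two points of [G]. *)
Lemma phi_inj i j (x y : R) : `|x - y| <= 2 -> phi i x = phi j y -> i = j /\ x = y.
Proof.
have aux a b (u v : R) : (a < b)%N -> `|u - v| <= 2 -> phi a u != phi b v.
  move=> ab; rewrite ler_norml => huv.
  have : (a%:R + 1) * h <= b%:R * h.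
    by rewrite ler_wpM2r//; [exact: ltW | rewrite natr1 ler_nat].
  move=> H; apply/eqP; rewrite /Defs.phi; move: H (h_gt2beta).
  set k := h; move: (beta_gt0); nra.
move=> hxy E; case: (ltngtP i j) => ij.
- by have := aux _ _ _ _ ij hxy; rewrite E eqxx.
- by have := aux _ _ y x ij; rewrite distrC E eqxx => /(_ hxy).
- split=> //; move: E; rewrite ij /Defs.phi => /addIr.
  by apply: mulfI; rewrite gt_eqF.
Qed.

Definition cyl (w : seq nat) (x : R) : R := foldr phi x w.

Lemma cyl_cat u v x : cyl (u ++ v) x = cyl u (cyl v x).
Proof. by rewrite /cyl foldr_cat. Qed.

Lemma cylE w x : cyl w x = beta ^+ size w * x + cyl w 0.
Proof.
elim: w => [|a w IH] /=; first by rewrite expr0 mul1r addr0.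
by rewrite IH /Defs.phi exprS; ring.
Qed.

Lemma cyl_nseq0 n x : cyl (nseq n 0%N) x = beta ^+ n * x.
Proof.
elim: n => [|n IH] /=; first by rewrite expr0 mul1r.
by rewrite IH /Defs.phi mul0r addr0 exprS mulrA.
Qed.

Local Notation letters := (all (fun a => a <= N)%N).

Lemma mem_cyl w x : letters w -> G x -> G (cyl w x).
Proof.
by elim: w => //= a w IH /andP[aN wN] Gx; apply: mem_phi => //; exact: IH.
Qed.

(** If [phi_w(y)] belongs to [G], its address must begin with [w], for [y] may
leave the unit interval by 1 without disturbing the digits of [w]. *)
Lemma cyl_mem_inv w (y : R) : letters w -> -1 <= y <= 2 -> G (cyl w y) -> G y.
Proof.
have bnd u : letters u -> forall z, -1 <= z <= 2 -> -1 <= cyl u z <= 2.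
  elim: u => //= a u IH /andP[aN uN] z /(IH uN).
  have := digit_bound aN; have : 0 <= a%:R * h by rewrite mulr_ge0// ltW.
  by rewrite /Defs.phi; move: (beta_gt0) (beta_lt1); set k := _ * h; nra.
elim: w => //= a w IH /andP[aN wN] hy Gy; apply: IH => //.
have [i [z [iN Gz /phi_inj[|_ ->//]]]] := phi_decomp Gy.
by have := bnd _ wN _ hy; have := attractor_itv Gz; rewrite ler_norml; lra.
Qed.

Lemma cyl_prefix v w x y : letters v -> letters w -> G x -> G y ->
  (size v <= size w)%N -> cyl w x = cyl v y -> v = take (size v) w.
Proof.
move=> + + Gx Gy; elim: v w => [|a v IH] [|b w]//= /andP[aN vN] /andP[bN wN].
rewrite ltnS => svw /phi_inj[|-> /IH <-//].
have := attractor_itv (mem_cyl vN Gy); have := attractor_itv (mem_cyl wN Gx).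
by rewrite ler_norml; lra.
Qed.

Lemma cyl_decomp n x : G x -> exists w y, [/\ words N n w, G y & x = cyl w y].
Proof.
elim: n x => [|n IH] x Gx; first by exists [::], x.
have [i [x' [iN Gx' ->]]] := phi_decomp Gx.
have [w [y [[<- wN] Gy ->]]] := IH _ Gx'.
by exists (i :: w), y; split => //; split => //=; rewrite iN.
Qed.

Lemma cyl_add f g n x y :
  cyl (mkseq (fun p => f p + g p)%N n) (x + y) =
  cyl (mkseq f n) x + cyl (mkseq g n) y.
Proof.
elim: n f g => [|n IH] f g //; rewrite !mkseq_cons /=.
by rewrite (IH (f \o succn) (g \o succn)) /Defs.phi natrD; ring.
Qed.

Lemma cyl_sub f g n x y : (forall p, (p < n)%N -> (g p <= f p)%N) ->
  cyl (mkseq (fun p => f p - g p)%N n) (x - y) =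
  cyl (mkseq f n) x - cyl (mkseq g n) y.
Proof.
move=> gf; apply/eqP; rewrite eq_sym subr_eq -cyl_add subrK; apply/eqP.
congr (cyl _ _); apply/(@eq_from_nth _ 0%N); rewrite ?size_mkseq// => p pn.
by rewrite !nth_mkseq// subnK// gf.
Qed.

Lemma letters_mkseq f n :
  (forall p, (p < n)%N -> (f p <= N)%N) -> letters (mkseq f n).
Proof. by move=> H; apply/(all_nthP 0%N) => p; rewrite size_mkseq => pn; rewrite nth_mkseq// H. Qed.

(** The sum has digits [f p + g p], and these are its only possible digits by
[phi_inj]; so a sum lying in [G] involves no carry. *)
Lemma digits_add_le f g n x :
  (forall p, (p < n)%N -> (f p <= N)%N) -> (forall p, (p < n)%N -> (g p <= N)%N) ->
  G x -> G (cyl (mkseq f n) x + cyl (mkseq g n) 0) ->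
  forall p, (p < n)%N -> (f p + g p <= N)%N.
Proof.
move=> + + Gx; elim: n f g => [|n IH] f g fN gN; first by [].
rewrite !mkseq_cons /= => H.
have Gf : G (cyl (mkseq (fun p => f p.+1) n) x).
  by apply: mem_cyl => //; apply: letters_mkseq => p pn; exact: fN.
have Gg : G (cyl (mkseq (fun p => g p.+1) n) 0).
  by apply: mem_cyl; [apply: letters_mkseq => p pn; exact: gN | exact: attractor0].
have [i [z [iN Gz E]]] := phi_decomp H.
have [||fgi zE] := @phi_inj (f 0 + g 0)%N i
    (cyl (mkseq (fun p => f p.+1) n) x + cyl (mkseq (fun p => g p.+1) n) 0) z.
- by have := attractor_itv Gz; have := attractor_itv Gf; have := attractor_itv Gg; rewrite ler_norml; lra.
- by rewrite -E /Defs.phi natrD; ring.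
case=> [_|p pn]; first by rewrite fgi.
by apply: (IH (f \o succn) (g \o succn)) => // [q qn|q qn|]; [exact: fN | exact: gN | rewrite zE].
Qed.

(** A difference lying in [G] involves no borrow: if [i] is its first digit then
[i + g 0] is a first digit of the minuend, hence equals [f 0]. *)
Lemma digits_sub_le f g n x :
  (forall p, (p < n)%N -> (f p <= N)%N) -> (forall p, (p < n)%N -> (g p <= N)%N) ->
  G x -> G (cyl (mkseq f n) x - cyl (mkseq g n) 0) ->
  forall p, (p < n)%N -> (g p <= f p)%N.
Proof.
move=> + + Gx; elim: n f g => [|n IH] f g fN gN; first by [].
rewrite !mkseq_cons /= => H.
have Gf : G (cyl (mkseq (fun p => f p.+1) n) x).
  by apply: mem_cyl => //; apply: letters_mkseq => p pn; exact: fN.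
have Gg : G (cyl (mkseq (fun p => g p.+1) n) 0).
  by apply: mem_cyl; [apply: letters_mkseq => p pn; exact: gN | exact: attractor0].
have [i [z [iN Gz E]]] := phi_decomp H.
have [||fgi zE] := @phi_inj (f 0) (i + g 0)%N
    (cyl (mkseq (fun p => f p.+1) n) x - cyl (mkseq (fun p => g p.+1) n) 0) z.
- by have := attractor_itv Gz; have := attractor_itv Gf; have := attractor_itv Gg; rewrite ler_norml; lra.
- by move: E; rewrite /Defs.phi natrD; lra.
case=> [_|p pn]; first by rewrite fgi leq_addl.
by apply: (IH (f \o succn) (g \o succn)) => // [q qn|q qn|]; [exact: fN | exact: gN | rewrite zE].
Qed.

(** Multiplying a finite expansion in powers of [beta^-1] by [beta ^ n] yields the
left endpoint of a cylinder, with the digits read backwards. *)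
Lemma cyl_digits n (d : nat -> nat) :
  cyl (mkseq (fun p => d (n - p)%N) n) 0 =
  beta ^+ n * (h * \sum_(1 <= k < n.+1) (d k)%:R * beta ^- k).
Proof.
elim: n => [|n IH]; first by rewrite big_geq// mulr0 mulr0.
rewrite mkseq_cons /= subn0 (_ : (fun p => _) = (fun p => d (n - p)%N)); last first.
  by apply/funext => p; rewrite subSS.
rewrite IH [in RHS]big_nat_recr//= /Defs.phi.
set S := \sum_(_ <= _ < _) _; set D := _%:R * beta ^- _.
rewrite !mulrDr; congr (_ + _); first by rewrite exprS; ring.
rewrite /D; set c := (d _)%:R.
have E : beta ^+ n.+1 * beta ^- n.+1 = 1 by rewrite mulfV// expf_neq0// gt_eqF.
rewrite -[LHS]mul1r -E.
by move: (beta ^+ n.+1) (beta ^- n.+1) => x y; ring.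
Qed.

(** * Affine maps from the Cantor set into itself *)

(** Contracted images of the first level pieces of [G], and of the gaps between
consecutive ones, are shorter than a gap of [G]. So the cylinder containing the
image cannot change along a piece, nor from a piece to the next one. *)
Lemma contraction_one_cylinder r b : `|r| < 1 ->
  (forall x, G x -> G (r * x + b)) ->
  exists2 i, (i <= N)%N & forall x, G x -> exists2 y, G y & r * x + b = phi i y.
Proof.
move=> r1 fG.
have near x y i : (i <= N)%N -> G x -> G y -> `|r| * `|x - y| < h - beta ->
    (exists2 z, G z & r * x + b = phi i z) ->
    exists2 z, G z & r * y + b = phi i z.
  move=> iN Gx Gy xy [z Gz xz].
  have [j [z' [jN Gz' yz]]] := phi_decomp (fG _ Gy).
  exists z' => //; rewrite yz; congr (phi _ _); apply/esym.
  apply: (phi_separated (attractor_itv Gz) (attractor_itv Gz')).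
  by rewrite -xz -yz (_ : _ - _ = r * (x - y)) ?normrM//; ring.
have [i [z [iN Gz fz]]] := phi_decomp (fG _ attractor0).
exists i => //.
have r0 : 0 <= `|r| by [].
have within k x y : (k <= N)%N -> G x -> G y ->
    (exists2 z, G z & r * phi k x + b = phi i z) ->
    exists2 z, G z & r * phi k y + b = phi i z.
  move=> kN Gx Gy; apply: near => //; try exact: mem_phi.
  rewrite (_ : phi k x - phi k y = beta * (x - y)); last by rewrite /Defs.phi; ring.
  rewrite normrM (gtr0_norm beta_gt0).
  have : `|x - y| <= 1 by rewrite ler_norml; have := attractor_itv Gx; have := attractor_itv Gy; lra.
  move=> xy1; apply: (@le_lt_trans _ _ beta); last by have := h_gt2beta; lra.
  by rewrite mulrCA ler_piMr// ?(ltW beta_gt0)// mulr_ile1// ltW.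
have all_k k : (k <= N)%N ->
    exists2 z, G z & r * phi k 0 + b = phi i z.
  elim: k => [_|k IH kN].
    by exists z => //; rewrite -fz /Defs.phi mulr0 mul0r addr0.
  have /(within k _ _ (ltnW kN) attractor0 attractor1) H := IH (ltnW kN).
  apply: near H => //; [exact: mem_phi (ltnW kN) attractor1 | exact: mem_phi attractor0 |].
  rewrite distrC (_ : phi _ _ - phi _ _ = h - beta); last first.
    by rewrite /Defs.phi -natr1; ring.
  have hb : 0 < h - beta by have := h_gt2beta; have := beta_gt0; lra.
  by rewrite (gtr0_norm hb) gtr_pMl.
move=> x Gx; have [k [x' [kN Gx' ->]]] := phi_decomp Gx.
exact: within kN attractor0 Gx' (all_k k kN).
Qed.

(** The two isometries of the line that preserve [G]; the boolean records the
orientation of a small copy. *)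
Definition side (s : bool) (x : R) : R := if s then 1 - x else x.

(** A contraction maps [G] into a single cylinder [phi_i(G)], and [phi_i^-1 o f] is
an affine map of the same kind whose ratio is larger by a factor [beta^-1].
This can happen only finitely often, since the ratio is at most 1; a map of
ratio 1 or -1 permutes the endpoints 0 and 1. *)
Lemma affine_rigidity r b : r != 0 -> (forall x, G x -> G (r * x + b)) ->
  exists u s, [/\ letters u, `|r| = beta ^+ size u &
    forall x, r * x + b = cyl u (side s x)].
Proof.
move=> r0 fG.
have nr : 0 < `|r| by rewrite normr_gt0.
have [n] := expr_lt_ex (introT andP (conj beta_gt0 beta_lt1)) nr.
elim: n r b r0 fG {nr} => [|n IH] r b r0 fG.
  have := attractor_itv (fG _ attractor0); have := attractor_itv (fG _ attractor1); rewrite mulr0 add0r mulr1 expr0.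
  by case: (ler0P r) => _; lra.
have [r1 _|r1 nr] := leP 1 `|r|.
  have := attractor_itv (fG _ attractor0); have := attractor_itv (fG _ attractor1); rewrite mulr0 add0r mulr1.
  move=> ? ?; move: r1; have [rn|rp] := ler0P r => r1; exists [::]; rewrite expr0 /=.
  - exists true; split; [by [] | by lra |] => x; have -> : r = -1 by lra.
    have -> : b = 1 by lra.
    by rewrite mulN1r addrC.
  - exists false; split; [by [] | by lra |] => x; have -> : r = 1 by lra.
    have -> : b = 0 by lra.
    by rewrite mul1r addr0.
have [i iN fi] := contraction_one_cylinder r1 fG.
have bn0 : beta != 0 by rewrite gt_eqF.
have phiE x : r * x + b = phi i (r / beta * x + (b - i%:R * h) / beta).
  by rewrite /Defs.phi; move: (i%:R * h) => k; field.
have [||| u [s [uN ru fu]]] := IH (r / beta) ((b - i%:R * h) / beta).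
- by rewrite mulf_neq0// invr_eq0.
- move=> x Gx; have [y Gy] := fi _ Gx; rewrite phiE => /addIr/(mulfI bn0) -> //.
- by rewrite normrM normfV (gtr0_norm beta_gt0) ltr_pdivlMr// -exprSr.
exists (i :: u), s; split => /=; first by rewrite iN.
- rewrite exprS -ru normrM normfV (gtr0_norm beta_gt0).
  by rewrite mulrCA mulfV// mulr1.
- by move=> x; rewrite phiE fu.
Qed.

(** * Unions of translates *)

Section Translates.
Variables (m : nat) (t : 'I_m.+1 -> R).
Local Notation E := (Gamma_union G t).

Lemma Gamma_unionP x : E x <-> exists j g, G g /\ x = g + t j.
Proof.
split; first by move=> [j _ [g Gg <-]]; exists j, g.
by move=> [j [g [Gg ->]]]; exists j => //; exists g.
Qed.

Lemma mem_Gamma_union g j : G g -> E (g + t j).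
Proof. by move=> Gg; apply/Gamma_unionP; exists j, g. Qed.

Lemma Gamma_union_compact : compact E.
Proof.
have -> : E = \bigcup_(j in [set` enum 'I_m.+1]) translate G (t j).
  by congr bigcup; apply/seteqP; split => j //= _; rewrite mem_enum.
rewrite bigcup_seq; apply: bigsetU_compact => j _.
case: hG => _ Gc _; apply: continuous_compact Gc.
apply: continuous_subspaceT => x.
by apply: continuousD; [exact: cvg_id | exact: cvg_cst].
Qed.

(** Conjugating [t] reflects the union, because [G] is symmetric. *)
Lemma Gamma_union_conjugate : Gamma_union G (conjugate t) =
  (fun x => (1 + t ord_max) - x) @` E.
Proof.
apply/seteqP; split => x.
  move=> [j _ [g Gg <-]]; exists (1 - g + t (rev_ord j)).
    by apply: mem_Gamma_union; exact: attractor_symmetric.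
  by rewrite /conjugate; ring.
move=> [_ [j _ [g Gg <-]] <-]; exists (rev_ord j) => //.
exists (1 - g); first exact: attractor_symmetric.
by rewrite /conjugate rev_ordK; ring.
Qed.

Lemma increasing_le : increasing_from0 t -> forall i j : 'I_m.+1,
  (i <= j)%N -> t i <= t j.
Proof.
move=> [_ tlt] i j; rewrite leq_eqVlt => /orP[/eqP ij|/tlt/ltW//].
by have -> : i = j by exact: val_inj.
Qed.

Lemma Gamma_union_itv : increasing_from0 t -> forall x, E x -> 0 <= x <= 1 + t ord_max.
Proof.
move=> ht x /Gamma_unionP[j [g [Gg ->]]]; have := attractor_itv Gg.
have := increasing_le ht (leq0n j : (ord0 <= j)%N).
have := increasing_le ht (leq_ord j : (j <= @ord_max m)%N).
by rewrite (proj1 ht); lra.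
Qed.

(** Below [t_1] only the translate by [t_0 = 0] is present. *)
Lemma Gamma_union_near0 : (0 < m)%N -> increasing_from0 t ->
  exists2 c, 0 < c & forall x, E x -> x < c -> G x.
Proof.
move=> hm ht; exists (t (inord 1)).
  by rewrite -(proj1 ht); apply: (proj2 ht); rewrite inordK.
move=> x /Gamma_unionP[j [g [Gg ->]]].
have [->|j0] := eqVneq j ord0; first by rewrite (proj1 ht) addr0.
have : t (inord 1) <= t j.
  apply: increasing_le => //; rewrite inordK// lt0n.
  by apply: contra_neq j0 => j0; apply: val_inj.
by have := attractor_itv Gg; lra.
Qed.

(** The ratio of a small copy of [E] containing 0 is [beta ^ q] up to sign, by
rigidity. As 0 is the least point of [E], the copy fixes 0 if it preserves
orientation, and it sends the greatest point [1 + t_m] to 0 otherwise; the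
reversed copy of [E] is then a direct copy of the conjugate union. *)
Lemma small_piece_ratio : (0 < m)%N -> increasing_from0 t -> self_similar E ->
  exists2 q, (0 < q)%N &
    (forall j x, G x -> G (beta ^+ q * (x + t j))) \/
    (forall j x, G x -> G (beta ^+ q * (x + conjugate t j))).
Proof.
move=> hm ht Ess; have [c c0 cG] := Gamma_union_near0 hm ht.
pose B := 1 + t ord_max.
have EB : E B by apply: mem_Gamma_union; exact: attractor1.
have E0 : E 0 by rewrite -[0]addr0 -{2}(proj1 ht); apply: mem_Gamma_union; exact: attractor0.
have bnd := Gamma_union_itv ht; have /andP[_ B0] := bnd _ E0.
have B1 : 1 <= B.
  have := increasing_le ht (leq0n (@ord_max m) : (ord0 <= ord_max)%N).
  by rewrite (proj1 ht) /B; lra.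
have e0 : 0 < Num.min 1 (c / B).
  by rewrite lt_min ltr01 divr_gt0//; lra.
have [del del0 /(_ 0 E0)[r [b [/andP[dr]]]]] := self_similar_small_pieces Ess e0.
rewrite lt_min => /andP[r1 rc] fE [y Ey fy].
have r0 : r != 0 by rewrite -normr_gt0; apply: lt_le_trans dr.
have fG z : E z -> G (r * z + b).
  move=> Ez; apply: cG; first exact: fE.
  rewrite (_ : r * z + b = r * (z - y)); last by move: fy; lra.
  apply: le_lt_trans (ler_norm _) _; rewrite normrM.
  apply: (@le_lt_trans _ _ (`|r| * B)); last by rewrite -ltr_pdivlMr//; lra.
  rewrite ler_wpM2l// ler_norml; have := bnd _ Ez; have := bnd _ Ey; rewrite -/B; lra.
have [|u [s [uN ru _]]] := @affine_rigidity r b r0.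
  by move=> x Gx; apply: fG; rewrite -[x]addr0 -(proj1 ht); exact: mem_Gamma_union.
have uq : (0 < size u)%N.
  by rewrite lt0n; apply/eqP => u0; move: r1; rewrite ru u0 expr0 ltxx.
have f0 := attractor_itv (fG _ E0); have fB := attractor_itv (fG _ EB).
have := bnd _ Ey; rewrite -/B => yB.
exists (size u) => //; rewrite -ru; have [rn|rp] := ler0P r.
- right => j x Gx; have bE : b = - r * B.
    have : r * B <= r * y by rewrite ler_wnM2l//; case/andP: yB.
    by lra.
  rewrite (_ : _ * _ = r * (1 - x + t (rev_ord j)) + b).
    by apply: fG; apply: mem_Gamma_union; exact: attractor_symmetric.
  by rewrite bE /conjugate /B; ring.
- left => j x Gx; have bE : b = 0.
    have : 0 <= r * y by rewrite mulr_ge0 ?(ltW rp)//; case/andP: yB.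
    by lra.
  rewrite -[_ * _]addr0 -bE; apply: fG; exact: mem_Gamma_union.
Qed.

End Translates.

(** The set [beta ^ q (G + x)] has the length of a cylinder of order [q], so it
fits into [G] only as such a cylinder: the point [beta ^ q x] is [phi_w(y)] with
[y] and [y + 1] in [G], whence [y = 0] and [w] gives the digits of [x]. *)
Lemma T_of_scaled_translate q x : (0 < q)%N ->
  (forall y, G y -> G (beta ^+ q * (y + x))) -> T beta N x.
Proof.
move=> q0 H; exists q => //.
have Hx : G (beta ^+ q * x) by have := H _ attractor0; rewrite add0r.
have [w [y [[wq wN] Gy E]]] := cyl_decomp q Hx.
have : G (cyl w (y + 1)).
  rewrite cylE wq mulrDr mulr1 addrAC -wq -cylE -E.
  by rewrite -[X in _ + X]mulr1 wq -mulrDr addrC; apply: H; exact: attractor1.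
have y01 := attractor_itv Gy.
have y1 : -1 <= y + 1 <= 2 by lra.
move=> /(cyl_mem_inv wN y1)/attractor_itv y2.
have y0 : y = 0 by lra.
exists (fun k => nth 0%N w (q - k)); split.
  move=> k /andP[k1 kq]; apply: (all_nthP 0%N wN); by rewrite wq ltn_subrL k1 q0.
have bq : beta ^+ q != 0 by rewrite expf_neq0// gt_eqF.
apply: (mulfI bq); rewrite -cyl_digits E y0; congr (cyl _ _).
apply/(@eq_from_nth _ 0%N); rewrite ?size_mkseq// => p; rewrite wq => pq.
by rewrite nth_mkseq// subKn// ltnW.
Qed.

(** * The words of calW *)

Section Admissible.
Variables (m : nat) (t : 'I_m.+1 -> R) (tau : nat) (d : 'I_m.+1 -> nat -> nat).
Hypothesis (dP : forall j, is_expansion beta N tau (t j) (d j)).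
Local Notation E := (Gamma_union G t).

Lemma expansion_cyl j : beta ^+ tau * t j = cyl (mkseq (fun p => d j (tau - p))%N tau) 0.
Proof. by rewrite cyl_digits -(proj2 (dP j)). Qed.

Lemma digit_le j p : (p < tau)%N -> (d j (tau - p) <= N)%N.
Proof. by move=> pt; apply: (proj1 (dP j)); rewrite subn_gt0 pt leq_subr. Qed.

Lemma smax_ge j k : (d j k <= smax d k)%N.
Proof. by rewrite /smax; exact: (leq_bigmax (F := fun j => d j k)). Qed.

Lemma smax_le k : (1 <= k <= tau)%N -> (smax d k <= N)%N.
Proof. by move=> kt; apply/bigmax_leqP => j _; exact: (proj1 (dP j)). Qed.

Lemma nth_letters i p : letters i -> (nth 0%N i p <= N)%N.
Proof.
move=> iN; have [pi|pi] := ltnP p (size i); first exact: (all_nthP 0%N iN).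
by rewrite nth_default.
Qed.

Lemma mkseq_words i : words N tau i -> i = mkseq (nth 0%N i) tau.
Proof. by case=> <- _; rewrite mkseq_nth. Qed.

Lemma cyl_word_add i g j : words N tau i -> cyl i (g + t j) =
  cyl (mkseq (fun p => nth 0 i p + d j (tau - p))%N tau) g.
Proof.
move=> iN; rewrite -[in RHS](addr0 g) cyl_add -mkseq_words// -expansion_cyl.
by rewrite cylE [in RHS]cylE (proj1 iN); ring.
Qed.

Lemma cyl_word_sub i g j : words N tau i ->
  (forall p, (p < tau)%N -> (d j (tau - p) <= nth 0 i p)%N) ->
  cyl i (g - t j) = cyl (mkseq (fun p => nth 0 i p - d j (tau - p))%N tau) g.
Proof.
move=> iN H; rewrite -[in RHS](subr0 g) cyl_sub// -mkseq_words// -expansion_cyl.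
by rewrite cylE [in RHS]cylE (proj1 iN); ring.
Qed.

(** Membership in [Omega] means that the digits of each [t_j] can be added without
carry, and membership in [Omega_hat] that they can be subtracted without
borrow. *)
Lemma OmegaP i : words N tau i -> Omega N tau d i <->
  (forall j p, (p < tau)%N -> (nth 0 i p + d j (tau - p) <= N)%N).
Proof.
move=> iw; split=> [[_ iO] j p pt | iD].
  have kt : (0 < tau - p <= tau)%N by rewrite subn_gt0 pt leq_subr.
  have := iO _ kt; rewrite (subKn (ltnW pt)).
  by have := smax_ge j (tau - p); have := smax_le kt; clear; lia.
split=> // k /andP[k1 kt].
suff : (smax d k <= N - nth 0 i (tau - k))%N.
  have := @smax_le k; rewrite k1 kt => /(_ isT).
  by have := nth_letters (tau - k) (proj2 iw); clear; lia.
apply/bigmax_leqP => j _; have := iD j (tau - k)%N.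
by rewrite subKn// ltn_subrL k1 (leq_trans k1 kt) => /(_ isT); clear; lia.
Qed.

Lemma Omega_hatP i : words N tau i -> Omega_hat N tau d i <->
  (forall j p, (p < tau)%N -> (d j (tau - p) <= nth 0 i p)%N).
Proof.
move=> iw; split=> [[_ iO] j p pt | iD].
  have kt : (0 < tau - p <= tau)%N by rewrite subn_gt0 pt leq_subr.
  have := iO _ kt; rewrite (subKn (ltnW pt)).
  exact/leq_trans/smax_ge.
split=> // k /andP[k1 kt]; apply/bigmax_leqP => j _; have := iD j (tau - k)%N.
by rewrite subKn// ltn_subrL k1 (leq_trans k1 kt) => /(_ isT).
Qed.

Lemma calW_words a : calW N tau d a -> words N tau a.
Proof.
case=> -[i iO [j _ <-]]; have iw := proj1 iO; split; rewrite ?size_mkseq//;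
  apply: letters_mkseq => p pt.
- by apply: (proj1 (OmegaP iw)).
- by apply: leq_trans (leq_subr _ _) _; exact: nth_letters (proj2 iw).
Qed.

(** A word of [calW] codes a piece [Gamma + t_j] of a contracted copy of [E] that
lies entirely inside [G]. *)
Lemma calW_covered a z : calW N tau d a -> G z ->
  exists i s, [/\ words N tau i, forall x, E x -> G (cyl i (side s x)) &
    exists2 y, E y & cyl a z = cyl i (side s y)].
Proof.
case=> -[i iO [j _ <-]] Gz; have iw := proj1 iO.
- have iD := proj1 (OmegaP iw) iO.
  exists i, false; split => //=.
    move=> _ /Gamma_unionP[j' [g [Gg ->]]]; rewrite cyl_word_add//.
    by apply: mem_cyl => //; apply: letters_mkseq; exact: iD.
  by exists (z + t j); [exact: mem_Gamma_union | rewrite cyl_word_add].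
- have iD := proj1 (Omega_hatP iw) iO.
  exists i, true; split => //=.
    move=> _ /Gamma_unionP[j' [g [Gg ->]]]; rewrite opprD addrA cyl_word_sub//; last exact: iD.
    apply: mem_cyl; last exact: attractor_symmetric.
    apply: letters_mkseq => p pt; apply: leq_trans (leq_subr _ _) _.
    exact: nth_letters (proj2 iw).
  exists (1 - z + t j); first by apply: mem_Gamma_union; exact: attractor_symmetric.
  rewrite opprD addrA subKr cyl_word_sub//; exact: iD.
Qed.

(** Conversely, let a copy of [E] of order at least [tau] lie inside [G]. Since no
carry or borrow can occur in any of its pieces, the last [tau] letters of its
word [u] lie in [Omega] or [Omega_hat], and each piece is a cylinder whose last
[tau] letters are in [calW]. *)
Lemma calW_of_piece u s x : letters u -> (tau <= size u)%N ->
  (forall y, E y -> G (cyl u (side s y))) -> E x ->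
  exists u1 a g, [/\ letters u1, size u1 = (size u - tau)%N, calW N tau d a, G g &
    cyl u (side s x) = cyl (u1 ++ a) g].
Proof.
move=> uN ut uE; set k := (size u - tau)%N.
have uE1 : u = take k u ++ drop k u by rewrite cat_take_drop.
have [u1N u2N] : letters (take k u) /\ letters (drop k u).
  by apply/andP; rewrite -all_cat -uE1.
have u1s : size (take k u) = k by rewrite size_takel// leq_subr.
have u2w : words N tau (drop k u) by split => //; rewrite size_drop subKn.
have u2M := mkseq_words u2w.
have dw j : letters (mkseq (fun p => d j (tau - p))%N tau).
  by apply: letters_mkseq => p; exact: digit_le.
have d01 j : 0 <= beta ^+ tau * t j <= 1.
  by apply: attractor_itv; rewrite expansion_cyl; exact: mem_cyl attractor0.
move: uE; rewrite uE1 => uE /Gamma_unionP[j [g [Gg ->]]].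
case: s uE => /= uE.
- have fD j' : forall p, (p < tau)%N -> (d j' (tau - p) <= nth 0 (drop k u) p)%N.
    apply: (@digits_sub_le _ (fun p => d j' (tau - p))%N _ 1) => [p _|p pt||].
    + exact: nth_letters.
    + exact: digit_le.
    + exact: attractor1.
    rewrite -u2M -expansion_cyl; apply: (cyl_mem_inv u1N).
      by have := attractor_itv (mem_cyl u2N attractor1); have := d01 j'; lra.
    have := uE (0 + t j') (mem_Gamma_union t j' attractor0).
    rewrite cyl_cat add0r; congr (G (cyl _ _)).
    by rewrite cylE [in RHS]cylE (proj1 u2w); ring.
  exists (take k u), (mkseq (fun p => nth 0 (drop k u) p - d j (tau - p))%N tau), (1 - g).
  split => //.
  + right; exists (drop k u); last by exists j.
    exact/Omega_hatP.
  + exact: attractor_symmetric.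
  + by rewrite !cyl_cat opprD addrA cyl_word_sub//; exact: fD.
- have fD j' : forall p, (p < tau)%N -> (nth 0 (drop k u) p + d j' (tau - p) <= N)%N.
    apply: (@digits_add_le _ (fun p => d j' (tau - p))%N _ 0) => [p _|p pt||].
    + exact: nth_letters.
    + exact: digit_le.
    + exact: attractor0.
    rewrite -u2M -expansion_cyl; apply: (cyl_mem_inv u1N).
      by have := attractor_itv (mem_cyl u2N attractor0); have := d01 j'; lra.
    have := uE (0 + t j') (mem_Gamma_union t j' attractor0).
    by rewrite cyl_cat add0r [cyl (drop _ _) _]cylE (proj1 u2w) addrC.
  exists (take k u), (mkseq (fun p => nth 0 (drop k u) p + d j (tau - p))%N tau), g.
  split => //.
  + left; exists (drop k u); last by exists j.
    exact/OmegaP.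
  + by rewrite !cyl_cat cyl_word_add.
Qed.

End Admissible.

(** * The two implications *)

Lemma admissible_self_similar m (t : 'I_m.+1 -> R) :
  admissible beta N t -> self_similar (Gamma_union G t).
Proof.
case=> ht _ [tau [d [[tau0 _ _] dP [l tl cover]]]].
(* The candidates are the maps [x |-> phi_v (side s x) + t_j] with [v] of length
   at most [l]; the predicate [P] keeps those that map [E] into [G + t_j]. *)
pose I : finType := ('I_m.+1 * bool * l.-bseq 'I_N.+1)%type.
pose wd (i : I) : seq nat := [seq val a | a <- i.2].
pose P (i : I) := (0 < size (wd i))%N /\
  forall x, Gamma_union G t x -> G (cyl (wd i) (side i.1.2 x)).
pose r (i : I) : R := (-1) ^+ i.1.2 * beta ^+ size (wd i).
pose b (i : I) : R := cyl (wd i) (side i.1.2 0) + t i.1.1.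
have rbE i x : r i * x + b i = cyl (wd i) (side i.1.2 x) + t i.1.1.
  rewrite /r /b (cylE _ (side _ 0)) (cylE _ (side _ x)).
  by case: (i.1.2) => /=; rewrite ?expr0 ?expr1; ring.
apply: (@self_similar_finType R _ I P r b).
- by exists (0 + t ord0); apply: mem_Gamma_union; exact: attractor0.
- exact: Gamma_union_compact.
- move=> i [i0 _]; rewrite normrM normrX normrN1 expr1n mul1r.
  rewrite ger0_norm ?exprn_ge0 ?ltW// exprn_gt0//=.
  by rewrite exprn_ilt1// ?ltW// -lt0n.
- by move=> i x [_ iE] Ex; rewrite rbE; apply: mem_Gamma_union; exact: iE.
move=> _ /Gamma_unionP[j [g [Gg ->]]].
have [w [z [ww Gz ->]]] := cyl_decomp l Gg.
move: ww; rewrite -cover => -[n /andP[tn nl]].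
move=> [u [us uN] [_ [a Wa [v [vs vN] <-]] <-]].
have [i [s [[isz iN] iE [y Ey ay]]]] := calW_covered dP Wa (mem_cyl vN Gz).
have lN : letters (u ++ i) by rewrite all_cat uN.
have ls : (size [seq inord a : 'I_N.+1 | a <- u ++ i] <= l)%N.
  by rewrite size_map size_cat us isz subnK.
exists (j, s, Bseq ls), y.
have wdE : wd (j, s, Bseq ls) = u ++ i.
  rewrite /wd /= -map_comp -[RHS]map_id; apply/eq_in_map => c cin /=.
  by rewrite inordK// ltnS; exact: (allP lN).
split => //.
- split; first by rewrite wdE size_cat isz addn_gt0 tau0 orbT.
  by move=> x Ex; rewrite wdE cyl_cat; apply: mem_cyl => //; exact: iE.
- by rewrite rbE wdE /= !cyl_cat ay.
Qed.

Lemma self_similar_admissible m (t : 'I_m.+1 -> R) : (0 < m)%N ->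
  increasing_from0 t -> (forall j, T beta N (t j)) ->
  self_similar (Gamma_union G t) -> admissible beta N t.
Proof.
move=> hm ht tT Ess; split => //.
have [tau tauP] := is_tau_ex tT.
have /choice[d dP] : forall j, exists d, is_expansion beta N tau (t j) d.
  by case: tauP => _ tE _ j; exact: tE.
exists tau, d; split => //.
have [c c0 cG] := Gamma_union_near0 hm ht.
have bnd := Gamma_union_itv ht.
have GE g : G g -> Gamma_union G t g.
  by move=> Gg; rewrite -[g]addr0 -(proj1 ht); exact: mem_Gamma_union.
pose B := 1 + t ord_max.
have B0 : 0 < B.
  have := increasing_le ht (leq0n (@ord_max m) : (ord0 <= ord_max)%N).
  by rewrite (proj1 ht) /B; lra.
have c20 : 0 < c / 2 by lra.
(* The copies used below meet [0, c / 2] and have length less than [c / 2], so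
   they lie in [G]; their words are longer than [tau + p], so the factor from
   [calW] starts after the [p] leading zeros of [w']. *)
have [p pc] := expr_lt_ex (introT andP (conj beta_gt0 beta_lt1)) c20.
have e0 : 0 < Num.min (beta ^+ (tau + p)) (c / 2 / B).
  by rewrite lt_min exprn_gt0// divr_gt0.
have [del del0 pieces] := self_similar_small_pieces Ess e0.
have [l0 l0del] := expr_lt_ex (introT andP (conj beta_gt0 beta_lt1)) del0.
exists (tau + l0)%N; first exact: leq_addr.
apply/seteqP; split => [w|w [ws wN]].
  move=> [n /andP[tn nl]] [u [us uN] [_ [a /(calW_words dP)[asz aN] [v [vs vN] <-]] <-]].
  by split; [rewrite !size_cat us asz vs; move: tn nl; clear; lia | rewrite !all_cat uN aN].
pose w' := nseq p 0%N ++ w.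
have w'N : letters w' by rewrite all_cat wN andbT all_nseq orbT.
have w'G : G (cyl w' 0) by exact: mem_cyl attractor0.
have [r [b [/andP[dr]]]] := pieces _ (GE _ w'G).
rewrite lt_min => /andP[rp rc] fE [y Ey fy].
have r0 : r != 0 by rewrite -normr_gt0; apply: lt_le_trans dr.
have fG z : Gamma_union G t z -> G (r * z + b).
  move=> Ez; apply: cG; first exact: fE.
  rewrite (_ : r * z + b = cyl w' 0 + r * (z - y)); last by rewrite fy; ring.
  have : cyl w' 0 <= beta ^+ p.
    rewrite cyl_cat cyl_nseq0 ler_piMr ?exprn_ge0 ?(ltW beta_gt0)//.
    by case/andP: (attractor_itv (mem_cyl wN attractor0)).
  suff : r * (z - y) < c / 2 by lra.
  apply: le_lt_trans (ler_norm _) _; rewrite normrM.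
  apply: (@le_lt_trans _ _ (`|r| * B)); last by rewrite -ltr_pdivlMr.
  rewrite ler_wpM2l// ler_norml; have := bnd _ Ez; have := bnd _ Ey; rewrite -/B; lra.
have [|u [s [uN ru fu]]] := @affine_rigidity r b r0.
  by move=> x Gx; apply: fG; exact: GE.
have ul0 : (size u < l0)%N.
  by rewrite -(ltr_iXn2l beta_gt0 beta_lt1) -ru; apply: lt_le_trans dr.
have ut : (tau + p < size u)%N by rewrite -(ltr_iXn2l beta_gt0 beta_lt1) -ru.
have uE z : Gamma_union G t z -> G (cyl u (side s z)) by move=> Ez; rewrite -fu; exact: fG.
have [|u1 [a [g [u1N u1s Wa Gg E]]]] := calW_of_piece dP uN _ uE Ey.
  by apply: leq_trans (ltnW ut); exact: leq_addr.
have [asz aN] := calW_words dP Wa.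
have w's : size w' = (p + (tau + l0))%N by rewrite size_cat size_nseq ws.
have ua : u1 ++ a = take (size (u1 ++ a)) w'.
  apply: (@cyl_prefix _ _ 0 g) => //; first by rewrite all_cat u1N.
  - exact: attractor0.
  - by rewrite size_cat u1s asz w's; move: ul0; clear; lia.
  - by rewrite -E -fu.
have wE : w = drop p u1 ++ (a ++ drop (size (u1 ++ a)) w').
  have : drop p w' = w by rewrite drop_size_cat// size_nseq.
  rewrite -{1}(cat_take_drop (size (u1 ++ a)) w') -ua -catA drop_cat u1s.
  by rewrite ltn_subRL ut.
exists (size u - p)%N; first by rewrite /=; move: ut ul0; clear; lia.
exists (drop p u1).
  split; first by rewrite size_drop u1s; clear; lia.
  by move: u1N; rewrite -{1}(cat_take_drop p u1) all_cat => /andP[].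
exists (a ++ drop (size (u1 ++ a)) w') => //.
exists a => //; exists (drop (size (u1 ++ a)) w') => //.
split; first by rewrite size_drop w's size_cat u1s asz; move: ut ul0; clear; lia.
by move: w'N; rewrite -{1}(cat_take_drop (size (u1 ++ a)) w') all_cat => /andP[].
Qed.

End Cantor.

Theorem theorem1p5 (R : realType) (N m : nat) (beta : R) (t : 'I_m.+1 -> R)
    (Gamma : set R)
    (hN : (0 < N)%N) (hm : (0 < m)%N)
    (hbeta : 0 < beta < 1 / (2 * N + 1)%:R)
    (ht : increasing_from0 t)
    (hGamma : is_attractor beta N Gamma) :
  self_similar (Gamma_union Gamma t) <->
  (admissible beta N t \/ admissible beta N (conjugate t)).
Proof.
have conjE := Gamma_union_conjugate hN hbeta hGamma t.
split=> [Ess|[adm|adm]].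
- have [q q0 [H|H]] := small_piece_ratio hN hbeta hGamma hm ht Ess.
  + left; apply: (self_similar_admissible hN hbeta hGamma) => // j.
    by apply: (T_of_scaled_translate hN hbeta hGamma q0); exact: H.
  + right; apply: (self_similar_admissible hN hbeta hGamma) => //.
    * exact: increasing_conjugate.
    * by move=> j; apply: (T_of_scaled_translate hN hbeta hGamma q0); exact: H.
    * by rewrite conjE; exact: self_similar_flip.
- exact: admissible_self_similar hN hbeta hGamma _ _ adm.
- rewrite -(image_flipK (Gamma_union Gamma t) (1 + t ord_max)) -conjE.
  by apply: self_similar_flip; exact: admissible_self_similar hN hbeta hGamma _ _ adm.
Qed.
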